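(* Let $r$ be a positive integer and $\varepsilon > 0$. Then, for every $\alpha \in \mathcal{S}_{r+\varepsilon}$, the sequence $s = (s_n)_{n \in \mathbb{Z}}$ given by $s_n = \chi_{[0,1/2)}(\alpha n^r + 1/4)$ obeys $R(s) = T(s) = \infty$.
   Context: $\mathbb{T} = \mathbb{R}/\mathbb{Z}$, and $\langle x \rangle = \mathrm{dist}(x,\mathbb{Z})$. The argument $\alpha n^r + 1/4$ is taken in $\mathbb{T}$ and $[0,1/2)$ is regarded as an arc of $\mathbb{T}$. For $\tau > 0$, $$\mathcal{S}_\tau = \{ \alpha \in \mathbb{T} : \langle q\alpha \rangle < q^{-\tau} \text{ for infinitely many odd positive integers } q \}.$$ For a two-sided sequence $\omega = (\omega_k)_{k\in\mathbb{Z}}$ over a finite alphabet and $n \ge 1$, let $R_n(\omega) = 1 + \frac{1}{n} \sup \{ m : \omega_k = \omega_{k+n} \text{ for } 1 \le k \le m \}$ and $T_n(\omega) = 1 + \frac{1}{n} \sup \{ m : \omega_k = \omega_{k+n} \text{ and } \omega_{n+1-k} = \omega_{1-k} \text{ for } 1 \le k \le m \}$, where $m$ ranges over positive integers and $\sup\emptyset = 0$; set $R(\omega) = \limsup_{n\to\infty} R_n(\omega)$ and $T(\omega) = \limsup_{n\to\infty} T_n(\omega)$, elements of $[1,\infty]$. *)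

(* Defs.v *)
From HB Require Import structures.
From mathcomp Require Import all_boot all_order all_algebra.
From mathcomp Require Import generic_quotient ring_quotient archimedean.
From mathcomp Require Import all_classical all_reals all_analysis.

Set Implicit Arguments.
Unset Strict Implicit.
Unset Printing Implicit Defensive.

Import Order.TTheory GRing.Theory Num.Theory.

Local Open Scope classical_set_scope.
Local Open Scope ring_scope.

Section Torus.
Variable R : realType.

(* The subgroup Z of R; [Num.int_num_subdef] underlies [Num.int]. *)
Definition int_subgroup : zmodClosed R := (@Num.int_num_subdef R : {pred R}).

(* Despite its name, [{ideal_quot I}] is the quotient group by an arbitrary
   additive subgroup [I]. *)
Definition torus : zmodType := {ideal_quot int_subgroup}.

Definition to_torus (x : R) : torus := (\pi_{ideal_quot int_subgroup} x)%qT.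

Definition dist_int (x : R) : R := inf [set `|x - k%:~R| | k in [set: int]].

(* <a>, for a class [a]; independent of the representative, see
   [torus_norm_to_torus]. *)
Definition torus_norm (a : torus) : R := dist_int (generic_quotient.repr a).

Definition half_arc : set torus := to_torus @` `[0, 2^-1[.

(* 0 is not odd, so the integers q below are positive. *)
Definition S_ (tau : R) : set torus :=
  [set a | infinite_set
             [set q : nat | odd q /\ torus_norm (a *+ q) < q%:R `^ (- tau)]].

(* The indicator function of the arc takes its values in the alphabet [bool]. *)
Definition power_coding (r : nat) (a : torus) (n : int) : bool :=
  a *~ (n ^+ r) + to_torus (4^-1) \in half_arc.

Lemma to_torus_is_zmod_morphism : zmod_morphism to_torus.
Proof. exact: pi_is_zmod_morphism. Qed.

HB.instance Definition _ :=
  GRing.isZmodMorphism.Build R torus to_torus to_torus_is_zmod_morphism.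

Lemma to_torusP (x y : R) :
  to_torus x = to_torus y <-> exists k : int, x = y + k%:~R.
Proof.
split=> [/eqP|[k ->]].
  rewrite /to_torus -Quotient.idealrBE => /intrP[k kE].
  by exists k; rewrite -kE addrC subrK.
by apply/eqP; rewrite /to_torus -Quotient.idealrBE addrAC subrr add0r intr_int.
Qed.

Lemma to_torus_surj (a : torus) : exists x, to_torus x = a.
Proof. by exists (generic_quotient.repr a); exact: reprK. Qed.

Lemma dist_intDz (x : R) (k : int) : dist_int (x + k%:~R) = dist_int x.
Proof.
rewrite /dist_int; congr (inf _); apply/seteqP; split=> _ [j _ <-] /=.
  by exists (j - k) => //; rewrite intrB opprB addrA.
by exists (j + k) => //; rewrite intrD opprD addrACA subrr addr0.
Qed.

Lemma torus_norm_to_torus (x : R) : torus_norm (to_torus x) = dist_int x.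
Proof.
have /to_torusP[k xE] : to_torus (generic_quotient.repr (to_torus x)) = to_torus x.
  exact: reprK.
by rewrite /torus_norm xE dist_intDz.
Qed.

End Torus.

Section Repetition.
Variables (R : realType) (A : finType).

(* The supremum of a set of positive integers, with sup of the empty set equal
   to 0 ([ereal_sup] gives -oo there). *)
Definition sup_pos (M : set nat) : \bar R :=
  maxe 0%E (ereal_sup [set (m%:R)%:E | m in M]).

Definition R_lengths (w : int -> A) (n : nat) : set nat :=
  [set m | (0 < m)%N /\
    forall k : nat, (1 <= k <= m)%N -> w k%:Z = w (k%:Z + n%:Z)].

Definition T_lengths (w : int -> A) (n : nat) : set nat :=
  [set m | (0 < m)%N /\
    forall k : nat, (1 <= k <= m)%N ->
      w k%:Z = w (k%:Z + n%:Z) /\ w (n%:Z + 1 - k%:Z) = w (1 - k%:Z)].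

(* Only n >= 1 is meaningful; the value at n = 0 is irrelevant to the limsup. *)
Definition Rn (w : int -> A) (n : nat) : \bar R :=
  (1 + (n%:R^-1)%:E * sup_pos (R_lengths w n))%E.

Definition Tn (w : int -> A) (n : nat) : \bar R :=
  (1 + (n%:R^-1)%:E * sup_pos (T_lengths w n))%E.

Definition Rlimsup (w : int -> A) : \bar R := limn_esup (Rn w).

Definition Tlimsup (w : int -> A) : \bar R := limn_esup (Tn w).

End Repetition.

Arguments Rn R {A} w n.
Arguments Tn R {A} w n.
Arguments Rlimsup R {A} w.
Arguments Tlimsup R {A} w.

(* Main.v *)
Require Import Defs.
From mathcomp Require Import all_boot all_order all_algebra.
From mathcomp Require Import zify lra.
From mathcomp Require Import all_classical all_reals all_analysis.

(** Represent [alpha] by a real [x].  Each odd [q] witnessing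
    [alpha \in S_(r + eps)] comes with an integer [p] such that
    [|x q - p| < q^-(r + eps)].  For [|n| <= K q] this gives
    [|n^r (x q - p)| < K^r q^-eps], which is below [1/4] once [q] is large
    compared with [K] ([S_good_approx]), so that [x n^r] lies within [1/(4q)] of
    the fraction [p n^r / q].

    The letter [s_n] records whether [x n^r] lies in the arc [[-1/4, 1/4)].
    Because [q] is odd, no fraction of denominator [q] comes closer than
    [1/(4q)] to an endpoint of this arc: [|j/q - (l +- 1/4)|] is [1/(4q)] times
    an odd integer.  Hence [s_n] does not change when [x n^r] is replaced by
    [p n^r / q] ([half_arc_near_fraction]), and it depends only on [n] modulo
    [q] ([power_coding_period]).

    So on the window [[-K q, K q]] the sequence has period [q].  Taking
    [K = C + 1], both one-sided matches counted by [T_n] at [n = q] extend over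
    length [C q], whence [T_q >= 1 + C]; moreover [R_q >= T_q], as the matches
    counted by [R_q] satisfy fewer constraints.  Since [C] is arbitrary and
    there are infinitely many such [q], both upper limits are infinite. *)

Import Order.TTheory GRing.Theory Num.Theory.

Local Open Scope classical_set_scope.
Local Open Scope ring_scope.

Lemma infinite_nat_unbounded (A : set nat) :
  infinite_set A -> forall N : nat, exists2 n, A n & (N <= n)%N.
Proof.
move=> Ainf N; have [n [An]] :=
  infinite_setN0 (infinite_setD Ainf (finite_II N)).
by rewrite /= => /negP; rewrite -leqNgt => Nn; exists n.
Qed.

Lemma limn_esup_eqy (R : realType) (u : nat -> \bar R) :
  (forall C N : nat, exists2 n, (N <= n)%N & (C%:R%:E <= u n)%E) ->
  limn_esup u = +oo%E.
Proof.
move=> uP; apply/eqyP => A A0; apply: le_ereal_inf_tmp => _ [V [N _ NV] <-].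
have [n Nn un] := uP (Num.bound A) N.
apply: (@le_trans _ _ (u n)).
  by apply: le_trans un; rewrite lee_fin ltW // archi_boundP //; exact: ltW.
by apply: ereal_sup_ubound; exists n => //; exact: NV.
Qed.

Lemma dist_int_lt (R : realType) (y e : R) :
  dist_int y < e -> exists p : int, `|y - p%:~R| < e.
Proof.
by move=> /inf_lt; case=> [|_ [p _ <-] pe]; [exists `|y - 0%:~R|, 0|exists p].
Qed.

Lemma half_arc_to_torus (R : realType) (x : R) :
  half_arc (to_torus x) <-> exists k : int, k%:~R <= x < k%:~R + 2^-1.
Proof.
split=> [[t /=]|[k kx]].
  rewrite in_itv /= => t01 /esym/to_torusP[k ->].
  by exists k; rewrite lerDr addrC ltrD2l.
exists (x - k%:~R); first by rewrite /= in_itv /= subr_ge0 ltrBlDl.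
by apply/esym/to_torusP; exists k; rewrite subrK.
Qed.

(** The discreteness behind the coding's stability: a real cannot pass an integer
    threshold by moving less than 1 away from a different integer. *)
Lemma ler_int_near (R : realType) (z : R) (m e : int) :
  `|z - m%:~R| < 1 -> m != e -> (e%:~R <= z) = (e%:~R <= m%:~R :> R).
Proof.
rewrite ltr_norml => /andP[h1 h2] me; rewrite ler_int; have [em|em] := leP e m.
  have : e + 1 <= m by rewrite lezD1 lt_neqAle eq_sym me.
  by rewrite -(ler_int R) intrD; lra.
by have : m + 1 <= e; [rewrite lezD1|rewrite -(ler_int R) intrD; lra].
Qed.

(** Scaled by [4q] and shifted by [q], the endpoints of the arc become even
    integers, while the fraction [j/q] becomes [4j + q], which is odd.  The
    hypothesis says that the scaled [x] is within 1 of [4j + q], so both points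
    are on the same side of every endpoint. *)
Lemma half_arc_near_fraction (R : realType) (x : R) (j : int) (q : nat) :
  odd q -> `|x * q%:R - j%:~R| < 4^-1 ->
  (to_torus (x + 4^-1) \in @half_arc R) =
  (to_torus (j%:~R / q%:R + 4^-1) \in @half_arc R).
Proof.
move=> qodd xqj; have q0 : (0 : R) < q%:R by rewrite ltr0n odd_gt0.
pose z := 4 * (x * q%:R) + q%:R; pose m : int := 4 * j + q%:Z.
have mE : m%:~R = 4 * j%:~R + q%:R :> R by rewrite intrD intrM.
have zm : `|z - m%:~R| < 1.
  by move: xqj; rewrite mE /z !ltr_norml => /andP[? ?]; apply/andP; split; lra.
have cut (l : int) :
    ((2 * q%:Z * l)%:~R <= z) = ((2 * q%:Z * l)%:~R <= m%:~R :> R).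
  apply: ler_int_near zm _; apply/eqP => mE2.
  have : (odd q + q./2.*2 = q)%N by rewrite odd_double_half.
  by move: mE2; rewrite /m qodd -mulrA; move: (q%:Z * l) => c; lia.
(* Both endpoint conditions put in the form tested by [cut]; the right one is a
   negation because the arc is half-open. *)
have arcE (y : R) (k : int) : (k%:~R <= y + 4^-1 < k%:~R + 2^-1) =
    ((2 * q%:Z * (2 * k))%:~R <= 4 * (y * q%:R) + q%:R) &&
    ~~ ((2 * q%:Z * (2 * k + 1))%:~R <= 4 * (y * q%:R) + q%:R).
  have q4 : (0 : R) < 4 * q%:R by rewrite mulr_gt0.
  rewrite -ltNge -(ler_pM2l q4) -[X in _ && X = _](ltr_pM2l q4) !intrM !intrD intrM.
  by congr (_ && _); apply/idP/idP => ?; rewrite /=; lra.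
apply/idP/idP; rewrite !inE !half_arc_to_torus => -[k]; rewrite arcE => h; exists k.
  rewrite arcE divfK ?gt_eqF // -mE -!cut; exact: h.
rewrite arcE; move: h; rewrite divfK ?gt_eqF // -mE -!cut; exact.
Qed.

Lemma power_codingE (R : realType) (r : nat) (x : R) (n : int) :
  power_coding r (to_torus x) n =
  (to_torus (x * n%:~R ^+ r + 4^-1) \in @half_arc R).
Proof. by rewrite /power_coding -raddfMz -raddfD -rmorphXn mulrzr. Qed.

(** When [n] and [n + q] both satisfy the approximation bound, their letters are
    those of the fractions [p n^r / q] and [p (n + q)^r / q], which differ by an
    integer because [q] divides [(n + q)^r - n^r]. *)
Lemma power_coding_period (R : realType) (r : nat) (x : R) (p : int) (q : nat)
    (n : int) :
  odd q ->
  `|n%:~R| ^+ r * `|x * q%:R - p%:~R| < 4^-1 ->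
  `|(n + q%:Z)%:~R| ^+ r * `|x * q%:R - p%:~R| < 4^-1 ->
  power_coding r (to_torus x) n = power_coding r (to_torus x) (n + q%:Z).
Proof.
move=> qodd hn hnq; have q0 : (0 : R) < q%:R by rewrite ltr0n odd_gt0.
have red (k : int) : `|k%:~R| ^+ r * `|x * q%:R - p%:~R| < 4^-1 ->
    power_coding r (to_torus x) k =
    (to_torus ((p * k ^+ r)%:~R / q%:R + 4^-1) \in @half_arc R).
  move=> hk; rewrite power_codingE; apply: half_arc_near_fraction => //.
  by rewrite intrM rmorphXn mulrAC -mulrBl normrM normrX mulrC.
rewrite !red //; suff /to_torusP -> : exists k : int,
  (p * (n + q%:Z) ^+ r)%:~R / q%:R + 4^-1 =
  (p * n ^+ r)%:~R / q%:R + 4^-1 + k%:~R :> R by [].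
have [c cE] : exists c : int, (n + q%:Z) ^+ r = n ^+ r + c * q%:Z.
  exists (\sum_(i < r) (n + q%:Z) ^+ (r.-1 - i) * n ^+ i).
  by rewrite mulrC -[X in X * _](addKr n) [- n + _]addrC -subrXX subrKC.
exists (p * c); rewrite cE mulrDr intrD mulrDl addrAC; congr (_ + _).
by rewrite mulrA intrM mulfK // gt_eqF.
Qed.

(** This is where the excess [eps] in the exponent is spent: the factor [q^r] in
    [|n|^r <= K^r q^r] cancels against [q^-r], and the remaining [q^-eps]
    absorbs the constant [4 K^r] as soon as [q] exceeds its [1/eps]-th power. *)
Lemma S_good_approx (R : realType) (r : nat) (eps x : R) :
  0 < eps -> S_ (r%:R + eps) (to_torus x) ->
  forall K N : nat, exists (q : nat) (p : int), [/\ (N <= q)%N, odd q &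
    forall n : int, `|n| <= (K * q)%N%:Z ->
      `|n%:~R| ^+ r * `|x * q%:R - p%:~R| < 4^-1].
Proof.
move=> eps0 /infinite_nat_unbounded Sx K N.
pose A : R := 4 * K%:R ^+ r.
have A0 : 0 <= A by rewrite mulr_ge0 // exprn_ge0.
have [q [qodd]] := Sx (maxn N (Num.bound (A `^ eps^-1))).
rewrite -raddfMn torus_norm_to_torus -[x *+ q]mulr_natr => /dist_int_lt[p xqp].
rewrite geq_max => /andP[Nq bq]; exists q, p; split=> // n nKq.
have q0 : (0 : R) < q%:R by rewrite ltr0n odd_gt0.
have Aq : A < q%:R `^ eps.
  have <- : (A `^ eps^-1) `^ eps = A by rewrite -powRrM mulVf ?gt_eqF // powRr1.
  rewrite gt0_ltr_powR ?nnegrE ?powR_ge0 ?ler0n //.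
  by rewrite (lt_le_trans (archi_boundP (powR_ge0 _ _))) // ler_nat.
have qe0 : 0 < q%:R `^ eps by rewrite powR_gt0.
apply: (@le_lt_trans _ _ ((K%:R * q%:R) ^+ r * q%:R `^ (- (r%:R + eps)))).
  apply: ler_pM; rewrite ?exprn_ge0 //; last exact: ltW.
  rewrite lerXn2r ?nnegrE ?mulr_ge0 //.
  by rewrite -intr_norm -natrM -[X in _ <= X]/((K * q)%N%:Z%:~R) ler_int.
rewrite powRN powRD ?(gt_eqF q0) ?implybT // powR_mulrn ?ler0n // exprMn.
rewrite invfM mulrA mulfK ?expf_neq0 ?gt_eqF // ltr_pdivrMr //.
by move: Aq; rewrite /A => ?; lra.
Qed.

(** The guarded hypothesis also covers [m = 0], where the bound is the
    convention that the supremum of the empty set is 0. *)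
Lemma sup_pos_ge (R : realType) (M : set nat) (m : nat) :
  ((0 < m)%N -> M m) -> (m%:R%:E <= sup_pos R M)%E.
Proof.
case: m => [|m] Mm; rewrite /sup_pos le_max ?lexx //.
by apply/orP; right; apply: ereal_sup_ubound; exists m.+1 => //; exact: Mm.
Qed.

Lemma one_plus_sup_pos_ge (R : realType) (M : set nat) (q C : nat) :
  (0 < q)%N -> ((0 < C * q)%N -> M (C * q)%N) ->
  (C%:R%:E <= 1 + (q%:R^-1)%:E * sup_pos R M)%E.
Proof.
move=> q0 /(sup_pos_ge R) h.
apply: (@le_trans _ _ (1 + (q%:R^-1)%:E * (C * q)%:R%:E)%E).
  rewrite -EFinM -EFinD lee_fin natrM mulrCA mulVf ?pnatr_eq0 -?lt0n //.
  by rewrite mulr1 lerDr.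
by rewrite leeD2l // lee_pmul2l // lte_fin invr_gt0 ltr0n.
Qed.

Theorem theorem10 (R : realType) (r : nat) (eps : R) (hr : (0 < r)%N)
    (heps : 0 < eps) (alpha : torus R) (halpha : S_ (r%:R + eps) alpha) :
  Rlimsup R (power_coding r alpha) = +oo%E /\
  Tlimsup R (power_coding r alpha) = +oo%E.
Proof.
have [x xE] := to_torus_surj alpha; move: halpha; rewrite -{}xE => Sx.
set w := power_coding r (to_torus x).
(* One [q] serves both halves of the statement: all that is needed is a long
   symmetric match at [q], since it contains a one-sided one. *)
have long C N : exists q : nat,
    [/\ (N <= q)%N, (0 < q)%N, T_lengths w q `<=` R_lengths w q &
      (0 < C * q)%N -> T_lengths w q (C * q)%N].
  have [q [p [Nq qodd near]]] := S_good_approx _ _ _ _ heps Sx C.+1 N.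
  exists q; split=> // [|m [m0 mT]|Cq0]; first exact: odd_gt0.
    by split=> // k /mT[].
  have period (n : int) : - (C * q)%N%:Z <= n <= (C * q)%N%:Z -> w n = w (n + q%:Z).
    move=> /andP[n1 n2]; apply: (power_coding_period _ _ _ p) => //; apply: near;
      rewrite mulSn PoszD ler_norml; apply/andP; split; lia.
  split=> // k /andP[k1 kC]; split; first by apply: period; lia.
  (* The reflected match: compare the letters at [1 - k] and [1 - k + q]. *)
  rewrite [RHS]period; last by lia.
  by congr w; lia.
split; apply: limn_esup_eqy => C N; have [q [Nq q0 TR Tq]] := long C N;
  exists q => //; apply: one_plus_sup_pos_ge => //.
by move=> /Tq/TR.
Qed.
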